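(* Let $\mathbf m,\mathbf n$ be positive integers with $m=\mathbf m^2$ dividing $n=\mathbf n^2$, and $G=\mathbb Z_m\times\mathbb Z_n=\langle g_1\rangle\times\langle g_2\rangle$. Let $V=kX_1\oplus kX_2\in{}^G_G\mathcal{YD}$ be a direct sum of one-dimensional Yetter–Drinfeld modules with finite-dimensional Nichols algebra $\mathscr B=\mathscr B(V)$, with coaction $X_i\mapsto h_i\otimes X_i$ and action $h_i\diamond X_j=q_{ij}X_j$, where $h_1,h_2$ generate $G$. Write $h_1=g_1^{\alpha_1}g_2^{\alpha_2}$, $h_2=g_1^{\beta_1}g_2^{\beta_2}$, $g_1=h_1^{s_1}h_2^{s_2}$, $g_2=h_1^{t_1}h_2^{t_2}$ with $\alpha_i,\beta_i,s_i,t_i\in\mathbb N$. Let $0\le a,b<\mathbf m$, $0\le d<\mathbf n$ and $J=J_{a,b,d}$. Then both $g_1^{\mathbf m}$ and $g_2^{\mathbf n}$ lie in the center of $\mathscr B^J\#kG=(\mathscr B\#kG)^J$ if and only if $$\zeta_m^{a\alpha_1\mathbf m}\zeta_{\mathbf m\mathbf n}^{b\alpha_2\mathbf m}=q_{11}^{\mathbf ms_1}q_{21}^{\mathbf ms_2},\qquad \zeta_m^{a\beta_1\mathbf m}\zeta_{\mathbf m\mathbf n}^{b\beta_2\mathbf m}=q_{12}^{\mathbf ms_1}q_{22}^{\mathbf ms_2},$$ $$\zeta_n^{d\alpha_2\mathbf n}=q_{11}^{\mathbf nt_1}q_{21}^{\mathbf nt_2},\qquad \zeta_n^{d\beta_2\mathbf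 n}=q_{12}^{\mathbf nt_1}q_{22}^{\mathbf nt_2}.$$
   Context: $k$ is an algebraically closed field of characteristic $0$. ${}^G_G\mathcal{YD}$ is the category of (left-left) Yetter–Drinfeld modules over $kG$, $\mathscr B(V)$ the Nichols algebra of $V$ and $\mathscr B(V)\#kG$ its bosonization, a pointed Hopf algebra. Primitive $N$-th roots of unity $\zeta_N$ are chosen with $\zeta_m^{\mathbf m}=\zeta_{\mathbf m\mathbf n}^{\mathbf n}=\zeta_{\mathbf m}$, $\zeta_n^{\mathbf n}=\zeta_{\mathbf m\mathbf n}^{\mathbf m}=\zeta_{\mathbf n}$ (e.g. $\zeta_N=e^{2\pi i/N}$). $$J_{a,b,d}(g_1^{x_1}g_2^{x_2},g_1^{y_1}g_2^{y_2})=\zeta_m^{ax_1(y_1-y_1')}\zeta_{\mathbf m\mathbf n}^{bx_2(y_1-y_1')}\zeta_n^{dx_2(y_2-y_2'')}\quad(0\le x_1,y_1<m,\ 0\le x_2,y_2<n),$$ where $y'$ and $y''$ are the remainders of $y$ modulo $\mathbf m$ and $\mathbf n$. $J$ is extended to $\mathscr B\#kG$ bilinearly on $kG$ and by zero on elements of positive degree. $(\mathscr B\#kG)^J$ is the (in general non-associative) twisted algebra: the same coalgebra with product $x\circ y=J(x_1,y_1)x_2y_2J^{-1}(x_3,y_3)$ (Sweedler notation). An element is in the center if it commutes with all elements under $\circ$ (with $g\circ X_i$ versus $X_i\circ g$ on generators). *)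

(* Defs.v *)
From HB Require Import structures.
From mathcomp Require Import all_boot all_order all_algebra all_fingroup.
From mathcomp Require Import generic_quotient ring_quotient.
From mathcomp Require Import finmap.
From mathcomp.classical Require Import boolp.
From mathcomp.multinomials Require Import monalg.

Set Implicit Arguments.
Unset Strict Implicit.
Unset Printing Implicit Defensive.

Import GRing.Theory.
Local Open Scope ring_scope.
Local Open Scope quotient_scope.

Definition fin_dim (k : fieldType) (U : lmodType k) : Prop :=
  exists s : seq U, forall x, exists c : nat -> k,
    x = \sum_(i < size s) c i *: s`_i.

(* A one-dimensional (left-left) Yetter-Drinfeld module kX over kG: the
   coaction is X |-> yd_deg (x) X and the action is g X = yd_char g X.  The
   compatibility of the two, namely that the coaction sends g X to
   (g yd_deg g^-1) (x) g X, is the last field. *)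
Record yd1 (k : fieldType) (gT : finGroupType) := Yd1 {
  yd_deg : gT;
  yd_char : gT -> k;
  yd_char1 : yd_char 1%g = 1;
  yd_charM : {morph yd_char : x y / (x * y)%g >-> x * y};
  yd_compat : forall g, (g * yd_deg * g^-1)%g = yd_deg
}.

Section Nichols.

(* V is the Yetter-Drinfeld module with basis X_i (i : I), the direct sum of
   the one-dimensional modules k X_i = V i. *)
Variables (k : fieldType) (gT : finGroupType) (I : choiceType).
Variable V : I -> yd1 k gT.

Local Notation word := {fmonom I}.
Local Notation letter := (@fmu I).

(* The tensor algebra T(V), a word in the free monoid on I standing for the
   corresponding monomial in the X_i. *)
Local Notation T := {malg k[fmonom I]}.

(* T(V) (x) T(V), the pair (u, v) standing for u (x) v. *)
Local Notation TT := {malg k[(fmonom I * fmonom I)%type]}.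

Definition word_deg (w : word) : gT := (\prod_(i <- (w : seq I)) yd_deg (V i))%g.

Definition word_char (w : word) (g : gT) : k :=
  \prod_(i <- (w : seq I)) yd_char (V i) g.

Definition tensor_act (g : gT) (x : T) : T :=
  \sum_(w <- msupp x) << x@_w * word_char w g *g w >>.

(* The component of x in the span of the words satisfying P. *)
Definition tensor_proj (P : pred word) (x : T) : T :=
  \sum_(w <- msupp x | P w) << x@_w *g w >>.

(* The product of the braided tensor product algebra T(V) (x) T(V):
   (u1 (x) v1)(u2 (x) v2) = u1 ((v1)_(-1) u2) (x) (v1)_(0) v2. *)
Definition braided_mul (x y : TT) : TT :=
  \sum_(p <- msupp x) \sum_(q <- msupp y)
    << x@_p * y@_q * word_char q.1 (word_deg p.2)
       *g (mmul p.1 q.1, mmul p.2 q.2) >>.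

(* The braided comultiplication of T(V): the algebra map T(V) -> T(V) (x) T(V)
   for which every X_i is primitive. *)
Definition word_comul (w : word) : TT :=
  foldr (fun i => braided_mul (<< (letter i, mone) >> + << (mone, letter i) >>))
    << (mone, mone) >> (w : seq I).

Definition tensor_comul (x : T) : TT :=
  \sum_(w <- msupp x) x@_w *: word_comul w.

Definition tensor_pair (x y : T) : TT :=
  \sum_(u <- msupp x) \sum_(v <- msupp y) << x@_u * y@_v *g (u, v) >>.

(* Two-sided ideals J of T(V) that are generated by homogeneous elements of
   degree >= 2, are Yetter-Drinfeld submodules and are coideals:
   Delta(J) is contained in J (x) T(V) + T(V) (x) J. *)
Record hopf_ideal (J : T -> Prop) : Prop := {
  hopf_ideal0 : J 0;
  hopf_idealD : forall x y, J x -> J y -> J (x + y);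
  hopf_idealMl : forall a x, J x -> J (a * x);
  hopf_idealMr : forall a x, J x -> J (x * a);
  hopf_ideal_graded : forall n x, J x -> J (tensor_proj (fun w => fdeg w == n) x);
  hopf_ideal_ge2 : forall x w, J x -> (fdeg w < 2)%N -> x@_w = 0;
  hopf_ideal_act : forall g x, J x -> J (tensor_act g x);
  hopf_ideal_coact :
    forall g x, J x -> J (tensor_proj (fun w => word_deg w == g) x);
  hopf_ideal_comul : forall x, J x -> exists s : seq (T * T),
    (forall p, p \in s -> J p.1 \/ J p.2) /\
    tensor_comul x = \sum_(p <- s) tensor_pair p.1 p.2
}.

(* The sum of all these ideals. *)
Definition in_nichols_ideal (x : T) : Prop := exists s : seq T,
  (forall y, y \in s -> exists J, hopf_ideal J /\ J y) /\ x = \sum_(y <- s) y.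

Definition nichols_ideal : {pred T} := fun x => `[< in_nichols_ideal x >].

Lemma malg_sumw (K : choiceType) (U : zmodType) (F : K -> k -> U)
    (x : {malg k[K]}) (d : {fset K}) :
  (forall w, F w 0 = 0) -> (msupp x `<=` d)%fset ->
  \sum_(w <- msupp x) F w x@_w = \sum_(w <- d) F w x@_w.
Proof.
move=> F0 le; rewrite (big_fset_incl _ le) //= => w _ /mcoeff_outdom ->.
exact: F0.
Qed.

Lemma malg_sumD (K : choiceType) (U : zmodType) (F : K -> k -> U) :
  (forall w, {morph F w : a b / a + b}) ->
  {morph (fun x : {malg k[K]} => \sum_(w <- msupp x) F w x@_w) : x y / x + y}.
Proof.
move=> FD x y /=.
have F0 w : F w 0 = 0 by apply: (addrI (F w 0)); rewrite -FD !addr0.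
rewrite (malg_sumw F0 (msuppD_le x y)).
rewrite (malg_sumw F0 (fsubsetUl (msupp x) (msupp y))).
rewrite (malg_sumw F0 (fsubsetUr (msupp x) (msupp y))).
by rewrite -big_split; apply: eq_bigr => w _; rewrite mcoeffD FD.
Qed.

Lemma malg_sumU (K : choiceType) (U : zmodType) (F : K -> k -> U) c w :
  (forall w, F w 0 = 0) ->
  \sum_(u <- msupp (<< c *g w >> : {malg k[K]})) F u << c *g w >>@_u = F w c.
Proof.
by move=> F0; rewrite (malg_sumw F0 msuppU_le) big_seq_fset1 mcoeffUU.
Qed.

Lemma malg_sum0 (K : choiceType) (U : zmodType) (F : K -> k -> U) :
  \sum_(u <- msupp (0 : {malg k[K]})) F u 0@_u = 0.
Proof. by rewrite msupp0 big_seq_fset0. Qed.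

Lemma tensor_actD g : {morph tensor_act g : x y / x + y}.
Proof.
exact: (malg_sumD (F := fun w a => << a * word_char w g *g w >>)
  (fun w a b => etrans (congr1 (mkmalgU w) (mulrDl _ _ _)) (monalgUD _ _ _))).
Qed.

Lemma tensor_act0 g : tensor_act g 0 = 0.
Proof. exact: (malg_sum0 (fun w a => << a * word_char w g *g w >>)). Qed.

Lemma tensor_comulD : {morph tensor_comul : x y / x + y}.
Proof.
exact: (malg_sumD (F := fun w a => a *: word_comul w)
  (fun w a b => scalerDl _ a b)).
Qed.

Lemma tensor_comul0 : tensor_comul 0 = 0.
Proof. exact: (malg_sum0 (fun w a => a *: word_comul w)). Qed.

#[local] Opaque tensor_act tensor_comul.

Lemma malg_scaleU (c a : k) (w : word) : c *: << a *g w >> = << c * a *g w >> :> T.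
Proof. by rewrite -mul_malgC malgM_def fgmulUU mul1m. Qed.

Lemma malg_scaleMr (c : k) (x y : T) : c *: (x * y) = x * (c *: y).
Proof.
rewrite -(mul_malgC c (x * y)) -(mul_malgC c y) (mulrA _ x y) (mulrA x _ y).
apply: (congr1 (fun z : T => z * y)).
rewrite (malgM_def _ x) (malgM_def x) fgmulUg fgmulgU; apply: eq_bigr => w _.
by rewrite mulrC mul1m mulm1.
Qed.

Lemma in_nichols_ideal_ind (P : T -> Prop) :
  P 0 -> (forall x y, P x -> P y -> P (x + y)) ->
  (forall J y, hopf_ideal J -> J y -> P y) ->
  forall x, in_nichols_ideal x -> P x.
Proof.
move=> P0 PD PJ x [s [sP ->]]; elim: s sP => [|y s IHs] sP.
  by rewrite big_nil.
rewrite big_cons; apply: PD; last first.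
  by apply: IHs => z zs; apply: sP; rewrite inE zs orbT.
by have [|J [HJ Jy]] := sP y; [rewrite inE eqxx | apply: PJ Jy].
Qed.

Lemma in_nichols_ideal_hopf J y : hopf_ideal J -> J y -> in_nichols_ideal y.
Proof.
move=> HJ Jy; exists [:: y]; rewrite big_seq1; split=> // z.
by rewrite inE => /eqP->; exists J.
Qed.

Lemma in_nichols_ideal0 : in_nichols_ideal 0.
Proof. by exists [::]; rewrite big_nil. Qed.

Lemma in_nichols_idealD x y :
  in_nichols_ideal x -> in_nichols_ideal y -> in_nichols_ideal (x + y).
Proof.
move=> [s [sP ->]] [t [tP ->]]; exists (s ++ t); rewrite big_cat; split=> // z.
by rewrite mem_cat => /orP[/sP|/tP].
Qed.

Lemma in_nichols_idealMl a x : in_nichols_ideal x -> in_nichols_ideal (a * x).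
Proof.
elim/in_nichols_ideal_ind => [|x1 x2 H1 H2|J y HJ Jy].
- by rewrite mulr0; apply: in_nichols_ideal0.
- by rewrite mulrDr; apply: in_nichols_idealD.
- by apply: (in_nichols_ideal_hopf HJ); apply: hopf_idealMl.
Qed.

Lemma in_nichols_idealMr a x : in_nichols_ideal x -> in_nichols_ideal (x * a).
Proof.
elim/in_nichols_ideal_ind => [|x1 x2 H1 H2|J y HJ Jy].
- by rewrite mul0r; apply: in_nichols_ideal0.
- by rewrite mulrDl; apply: in_nichols_idealD.
- by apply: (in_nichols_ideal_hopf HJ); apply: hopf_idealMr.
Qed.

Lemma in_nichols_ideal_ge2 x w :
  in_nichols_ideal x -> (fdeg w < 2)%N -> x@_w = 0.
Proof.
move=> + w2; elim/in_nichols_ideal_ind => [|x1 x2 H1 H2|J y HJ Jy].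
- by rewrite mcoeff0.
- by rewrite mcoeffD H1 H2 addr0.
- exact: hopf_ideal_ge2 HJ _ _ Jy w2.
Qed.

Lemma in_nichols_ideal_act g x :
  in_nichols_ideal x -> in_nichols_ideal (tensor_act g x).
Proof.
elim/in_nichols_ideal_ind => [|x1 x2 H1 H2|J y HJ Jy].
- by rewrite tensor_act0; apply: in_nichols_ideal0.
- by rewrite tensor_actD; apply: in_nichols_idealD.
- by apply: (in_nichols_ideal_hopf HJ); apply: hopf_ideal_act.
Qed.

Lemma nichols_ideal_zmod_closed : zmod_closed nichols_ideal.
Proof.
split=> [|x y /asboolP Hx /asboolP Hy]; apply/asboolP.
  exact: in_nichols_ideal0.
by apply: in_nichols_idealD => //; rewrite -mulN1r; apply: in_nichols_idealMl.
Qed.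

HB.instance Definition _ :=
  GRing.isZmodClosed.Build T nichols_ideal nichols_ideal_zmod_closed.

(* The Nichols algebra B(V) = T(V) / I(V). *)
Definition nichols := @Quotient.quot T nichols_ideal.

HB.instance Definition _ := GRing.Zmodule.on nichols.
HB.instance Definition _ := EqQuotient.on nichols.

Definition nichols_pi (x : T) : nichols := \pi_nichols x.

Lemma nichols_piP x y :
  reflect (in_nichols_ideal (x - y)) (nichols_pi x == nichols_pi y).
Proof.
apply: (iffP idP) => [|H].
  by rewrite -(Quotient.idealrBE nichols_ideal) => /asboolP.
by rewrite -(Quotient.idealrBE nichols_ideal); apply/asboolP.
Qed.

Lemma nichols_reprK x : nichols_pi (repr x) = x.
Proof. exact: reprK. Qed.

Lemma nichols_repr_pi x : in_nichols_ideal (repr (nichols_pi x) - x).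
Proof. by apply/nichols_piP; rewrite nichols_reprK. Qed.

Lemma nichols_pi_eq x y : in_nichols_ideal (x - y) -> nichols_pi x = nichols_pi y.
Proof. by move=> H; apply/eqP/nichols_piP. Qed.

Lemma nichols_pi_zmod : zmod_morphism nichols_pi.
Proof. exact: (raddfB (\pi_(Quotient.quot nichols_ideal))). Qed.

HB.instance Definition _ :=
  GRing.isZmodMorphism.Build T nichols nichols_pi nichols_pi_zmod.

Definition nichols_scale (c : k) (x : nichols) := nichols_pi (c *: repr x).
Definition nichols_mul (x y : nichols) := nichols_pi (repr x * repr y).

Lemma nichols_pi_scale c x : nichols_scale c (nichols_pi x) = nichols_pi (c *: x).
Proof.
apply: nichols_pi_eq; rewrite -scalerBr -mul_malgC.
by apply: in_nichols_idealMl; apply: nichols_repr_pi.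
Qed.

Lemma nichols_pi_mul x y :
  nichols_mul (nichols_pi x) (nichols_pi y) = nichols_pi (x * y).
Proof.
apply: nichols_pi_eq; set x' := repr _; set y' := repr _.
have -> : x' * y' - x * y = (x' - x) * y' + x * (y' - y).
  by rewrite mulrBl mulrBr addrA subrK.
apply: in_nichols_idealD.
  by apply: in_nichols_idealMr; apply: nichols_repr_pi.
by apply: in_nichols_idealMl; apply: nichols_repr_pi.
Qed.

Lemma nichols_ind (P : nichols -> Prop) :
  (forall x, P (nichols_pi x)) -> forall x, P x.
Proof. by move=> H x; rewrite -[x]nichols_reprK. Qed.

Fact nichols_mulA : associative nichols_mul.
Proof.
elim/nichols_ind => x; elim/nichols_ind => y; elim/nichols_ind => z.
by rewrite !nichols_pi_mul mulrA.
Qed.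

Fact nichols_mul1 : left_id (nichols_pi 1) nichols_mul.
Proof. by elim/nichols_ind => x; rewrite nichols_pi_mul mul1r. Qed.

Fact nichols_mulr1 : right_id (nichols_pi 1) nichols_mul.
Proof. by elim/nichols_ind => x; rewrite nichols_pi_mul mulr1. Qed.

Fact nichols_mulDl : left_distributive nichols_mul +%R.
Proof.
elim/nichols_ind => x; elim/nichols_ind => y; elim/nichols_ind => z.
by rewrite -raddfD !nichols_pi_mul -raddfD mulrDl.
Qed.

Fact nichols_mulDr : right_distributive nichols_mul +%R.
Proof.
elim/nichols_ind => x; elim/nichols_ind => y; elim/nichols_ind => z.
by rewrite -raddfD !nichols_pi_mul -raddfD mulrDr.
Qed.

Fact nichols_oner_neq0 : nichols_pi 1 != 0.
Proof.
rewrite -(raddf0 nichols_pi); apply/nichols_piP; rewrite subr0 => H.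
have := in_nichols_ideal_ge2 (w := mone) H; rewrite fdeg1 => /(_ isT)/eqP.
by rewrite mcoeffUU oner_eq0.
Qed.

HB.instance Definition _ := GRing.Zmodule_isNzRing.Build nichols
  nichols_mulA nichols_mul1 nichols_mulr1 nichols_mulDl nichols_mulDr
  nichols_oner_neq0.

Fact nichols_scaleA a b x :
  nichols_scale a (nichols_scale b x) = nichols_scale (a * b) x.
Proof. by elim/nichols_ind: x => x; rewrite !nichols_pi_scale scalerA. Qed.

Fact nichols_scale1 : left_id 1 nichols_scale.
Proof. by elim/nichols_ind => x; rewrite nichols_pi_scale scale1r. Qed.

Fact nichols_scaleDr : right_distributive nichols_scale +%R.
Proof.
move=> c; elim/nichols_ind => x; elim/nichols_ind => y.
by rewrite -raddfD !nichols_pi_scale -raddfD scalerDr.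
Qed.

Fact nichols_scaleDl x : {morph nichols_scale^~ x : a b / a + b}.
Proof.
by move=> a b; elim/nichols_ind: x => x; rewrite !nichols_pi_scale -raddfD scalerDl.
Qed.

HB.instance Definition _ := GRing.Zmodule_isLmodule.Build k nichols
  nichols_scaleA nichols_scale1 nichols_scaleDr nichols_scaleDl.

Fact nichols_scaleAl (c : k) (x y : nichols) : c *: (x * y) = c *: x * y.
Proof.
elim/nichols_ind: x => x; elim/nichols_ind: y => y.
rewrite /*%R /*:%R /= nichols_pi_mul !nichols_pi_scale nichols_pi_mul.
by rewrite scalerAl.
Qed.

HB.instance Definition _ := GRing.Lmodule_isLalgebra.Build k nichols
  nichols_scaleAl.

Fact nichols_scaleAr (c : k) (x y : nichols) : c *: (x * y) = x * (c *: y).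
Proof.
elim/nichols_ind: x => x; elim/nichols_ind: y => y.
rewrite /*%R /*:%R /= nichols_pi_mul !nichols_pi_scale nichols_pi_mul.
by rewrite malg_scaleMr.
Qed.

HB.instance Definition _ := GRing.Lalgebra_isAlgebra.Build k nichols
  nichols_scaleAr.

(* The action of G and the counit of B(V); see nichols_act_pi and
   nichols_counit_pi for the independence of the representative. *)
Definition nichols_act (g : gT) (x : nichols) : nichols :=
  nichols_pi (tensor_act g (repr x)).

Definition nichols_counit (x : nichols) : k := (repr x)@_mone.

(* A Sweedler representation of the comultiplication of B(V) followed by the
   coaction: the triples of the list, as pure tensors, sum up to
   x^(1) (x) (x^(2))_(-1) (x) (x^(2))_(0) in B(V) (x) kG (x) B(V); see
   nichols_comul_pi for the independence of the representative. *)
Definition nichols_comul (x : nichols) : seq (nichols * gT * nichols) :=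
  let D := tensor_comul (repr x) in
  [seq (D@_p *: nichols_pi << p.1 >>, word_deg p.2, nichols_pi << p.2 >>)
  | p <- msupp D].

Lemma nichols_act_pi g x : nichols_act g (nichols_pi x) = nichols_pi (tensor_act g x).
Proof.
apply: nichols_pi_eq; rewrite -[X in tensor_act g X - _](subrK x) tensor_actD addrK.
by apply: in_nichols_ideal_act; apply: nichols_repr_pi.
Qed.

Lemma nichols_counit_pi x : nichols_counit (nichols_pi x) = x@_mone.
Proof.
apply/eqP; rewrite -subr_eq0 -mcoeffB; apply/eqP.
apply: in_nichols_ideal_ge2; first exact: nichols_repr_pi.
by rewrite fdeg1.
Qed.

Section Comul.

Variables (U : lmodType k) (f : nichols -> gT -> nichols -> U).
Hypothesis fl : forall h s, linear (fun r => f r h s).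
Hypothesis fr : forall r h, linear (f r h).

Let F (z : TT) : U := \sum_(p <- msupp z)
  z@_p *: f (nichols_pi << p.1 >>) (word_deg p.2) (nichols_pi << p.2 >>).

Let FD : {morph F : x y / x + y}.
Proof.
exact: (malg_sumD (F := fun p a =>
  a *: f (nichols_pi << p.1 >>) (word_deg p.2) (nichols_pi << p.2 >>))
  (fun p a b => scalerDl _ a b)).
Qed.

Let F0 : F 0 = 0.
Proof.
exact: (malg_sum0 (fun p a =>
  a *: f (nichols_pi << p.1 >>) (word_deg p.2) (nichols_pi << p.2 >>))).
Qed.

Let FU c p : F << c *g p >> =
  c *: f (nichols_pi << p.1 >>) (word_deg p.2) (nichols_pi << p.2 >>).
Proof.
exact: (malg_sumU (F := fun p a =>
  a *: f (nichols_pi << p.1 >>) (word_deg p.2) (nichols_pi << p.2 >>))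
  c p (fun w => scale0r _)).
Qed.

Let piU c w : nichols_pi << c *g w >> = c *: nichols_pi << w >>.
Proof.
rewrite /*:%R /= nichols_pi_scale; congr nichols_pi.
by rewrite malg_scaleU mulr1.
Qed.

Let fDl h s : {morph f^~ h ^~ s : a b / a + b}.
Proof. by move=> a b; have := fl h s 1 a b; rewrite !scale1r. Qed.

Let fDr r h : {morph f r h : a b / a + b}.
Proof. by move=> a b; have := fr r h 1 a b; rewrite !scale1r. Qed.

Let f0l h s : f 0 h s = 0.
Proof. by apply: (addrI (f 0 h s)); rewrite -fDl !addr0. Qed.

Let f0r r h : f r h 0 = 0.
Proof. by apply: (addrI (f r h 0)); rewrite -fDr !addr0. Qed.

Let fZl c r h s : f (c *: r) h s = c *: f r h s.
Proof. by have := fl h s c r 0; rewrite !addr0 f0l addr0. Qed.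

Let fZr c r h s : f r h (c *: s) = c *: f r h s.
Proof. by have := fr r h c s 0; rewrite !addr0 f0r addr0. Qed.

Let fsuml (x : T) h s :
  \sum_(w <- msupp x) x@_w *: f (nichols_pi << w >>) h s = f (nichols_pi x) h s.
Proof.
rewrite [in RHS](monalgE x) raddf_sum /= (big_morph _ (fDl h s) (f0l h s)).
by apply: eq_bigr => w _; rewrite -fZl -piU.
Qed.

Let fsumr (x : T) (P : pred word) r h :
  \sum_(w <- msupp x | P w) x@_w *: f r h (nichols_pi << w >>) =
  f r h (nichols_pi (tensor_proj P x)).
Proof.
rewrite raddf_sum /= (big_morph _ (fDr r h) (f0r r h)).
by apply: eq_bigr => w _; rewrite -fZr -piU.
Qed.

Let F_pair (x y : T) : F (tensor_pair x y) =
  \sum_(u <- msupp x) \sum_(v <- msupp y)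
    x@_u * y@_v *: f (nichols_pi << u >>) (word_deg v) (nichols_pi << v >>).
Proof.
rewrite (big_morph _ FD F0); apply: eq_bigr => u _.
by rewrite (big_morph _ FD F0); apply: eq_bigr => v _; rewrite FU.
Qed.

Let F_pairl J x y : hopf_ideal J -> J x -> F (tensor_pair x y) = 0.
Proof.
move=> HJ Jx; rewrite F_pair exchange_big big1 // => v _.
rewrite (eq_bigr (fun u => y@_v *: (x@_u *:
  f (nichols_pi << u >>) (word_deg v) (nichols_pi << v >>)))); last first.
  by move=> u _; rewrite scalerA mulrC.
rewrite -scaler_sumr fsuml.
have -> : nichols_pi x = nichols_pi 0.
  by apply: nichols_pi_eq; rewrite subr0; apply: in_nichols_ideal_hopf Jx.
by rewrite raddf0 f0l scaler0.
Qed.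

Let F_pairr J x y : hopf_ideal J -> J y -> F (tensor_pair x y) = 0.
Proof.
move=> HJ Jy; rewrite F_pair big1 // => u _.
rewrite (partition_big word_deg xpredT) //= big1 // => g _.
rewrite (eq_bigr (fun v => x@_u *: (y@_v *:
  f (nichols_pi << u >>) g (nichols_pi << v >>)))); last first.
  by move=> v /eqP->; rewrite scalerA.
rewrite -scaler_sumr (fsumr y (fun v => word_deg v == g)).
have -> : nichols_pi (tensor_proj (fun v => word_deg v == g) y) = nichols_pi 0.
  apply: nichols_pi_eq; rewrite subr0; apply: (in_nichols_ideal_hopf HJ).
  exact: hopf_ideal_coact.
by rewrite raddf0 f0r scaler0.
Qed.

Let F_ideal x : in_nichols_ideal x -> F (tensor_comul x) = 0.
Proof.
move: FD F0 F_pairl F_pairr; move: (F) => G GD G0 G_pairl G_pairr.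
elim/in_nichols_ideal_ind => [|x1 x2 H1 H2|J y HJ Jy].
- by rewrite tensor_comul0.
- rewrite tensor_comulD GD.
  exact: etrans (congr2 (fun a b => a + b) H1 H2) (addr0 0).
have [s [sP ->]] := hopf_ideal_comul HJ Jy.
rewrite (big_morph _ GD G0) big_seq big1 // => p /sP[Jp|Jp].
  exact: G_pairl HJ Jp.
exact: G_pairr HJ Jp.
Qed.

Lemma nichols_comul_pi x :
  \sum_(p <- nichols_comul (nichols_pi x)) f p.1.1 p.1.2 p.2 =
  \sum_(p <- msupp (tensor_comul x)) (tensor_comul x)@_p *:
    f (nichols_pi << p.1 >>) (word_deg p.2) (nichols_pi << p.2 >>).
Proof.
transitivity (F (tensor_comul (repr (nichols_pi x)))).
  by rewrite big_map; apply: eq_bigr => p _; rewrite /= fZl.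
set r := repr _.
have E : tensor_comul r = tensor_comul (r - x) + tensor_comul x.
  by rewrite -tensor_comulD subrK.
apply: (etrans (congr1 F E)); apply: (etrans (FD _ _)).
apply: etrans (add0r (F (tensor_comul x))).
exact: (congr1 (fun a => a + _) (F_ideal (nichols_repr_pi x))).
Qed.

End Comul.

End Nichols.

Section Bosonization.

Variables (k : fieldType) (gT : finGroupType) (I : choiceType).
Variable V : I -> yd1 k gT.

(* The bosonization B(V)#kG, x standing for the sum over g of (x g)#g. *)
Definition bosonization := {ffun gT -> nichols V}.

Definition smash (r : nichols V) (g : gT) : bosonization :=
  [ffun h => if h == g then r else 0].

(* (r#g)(s#h) = r (g s) # gh *)
Definition boson_mul (x y : bosonization) : bosonization :=
  \sum_g \sum_h smash (x g * nichols_act g (y h)) (g * h)%g.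

(* A Sweedler representation, as a list of pure tensors, of the comultiplication
   r#g |-> r^(1) # (r^(2))_(-1) g (x) (r^(2))_(0) # g. *)
Definition boson_comul (x : bosonization) : seq (bosonization * bosonization) :=
  [seq (smash p.1.1 (p.1.2 * g)%g, smash p.2 g)
  | g <- enum gT, p <- nichols_comul (x g)].

(* (Delta (x) id) Delta *)
Definition boson_comul2 (x : bosonization) :
    seq (bosonization * bosonization * bosonization) :=
  [seq (q.1, q.2, p.2) | p <- boson_comul x, q <- boson_comul p.1].

(* The bilinear extension of F to kG, extended by zero to the elements of
   positive degree: the degree 0 part of r#g is (counit r) g. *)
Definition boson_ext (F : gT -> gT -> k) (x y : bosonization) : k :=
  \sum_g \sum_h nichols_counit (x g) * nichols_counit (y h) * F g h.

(* The product x o y = F(x1, y1) x2 y2 F^-1(x3, y3) of (B(V)#kG)^F.  As the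
   comultiplication is graded, the convolution inverse of the extension of F
   is the extension of the pointwise inverse of F on G. *)
Definition twisted_mul (F : gT -> gT -> k) (x y : bosonization) : bosonization :=
  \sum_(p <- boson_comul2 x) \sum_(q <- boson_comul2 y)
    (boson_ext F p.1.1 q.1.1 * boson_ext (fun g h => (F g h)^-1) p.2 q.2)
      *: boson_mul p.1.2 q.1.2.

(* (B(V)#kG)^F is not associative in general; its center consists of the
   elements that commute with all the others. *)
Definition in_twisted_center (F : gT -> gT -> k) (z : bosonization) : Prop :=
  forall x, twisted_mul F z x = twisted_mul F x z.

End Bosonization.

(* (x1, x2) with g = g1^x1 g2^x2, 0 <= x1 < #[g1] and 0 <= x2 < #[g2], which is
   unique when <g1> and <g2> are in direct product. *)
Definition exponents (gT : finGroupType) (g1 g2 g : gT) : nat * nat :=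
  if [pick x : 'I_#[g1]%g * 'I_#[g2]%g | g == (g1 ^+ x.1 * g2 ^+ x.2)%g]
    is Some x then (val x.1, val x.2) else (0%N, 0%N).

(* J_{a,b,d}; bm and bn are the square roots of m = #[g1] and n = #[g2].  The
   subtractions are exact. *)
Definition Jabd (k : fieldType) (gT : finGroupType) (g1 g2 : gT)
    (zeta : nat -> k) (bm bn a b d : nat) (g h : gT) : k :=
  let x := exponents g1 g2 g in let y := exponents g1 g2 h in
  zeta (bm ^ 2)%N ^+ (a * x.1 * (y.1 - y.1 %% bm))
  * zeta (bm * bn)%N ^+ (b * x.2 * (y.1 - y.1 %% bm))
  * zeta (bn ^ 2)%N ^+ (d * x.2 * (y.2 - y.2 %% bn)).

(* Main.v *)
Require Import Defs.
From mathcomp Require Import all_boot all_order all_algebra all_fingroup.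
From mathcomp Require Import generic_quotient cyclic finmap.
From mathcomp.multinomials Require Import monalg.

Import GRing.Theory.
Local Open Scope ring_scope.

(* In the twice iterated comultiplication of w#h (w a word in the X_i) only
   1#(deg w)h (x) w#h (x) 1#h survives in J(x1, y1) x2 y2 J^-1(x3, y3), so that
     g o (w#h) = J(g, (deg w)h) J(g, h)^-1 chi_w(g) w#gh,
     (w#h) o g = J((deg w)h, g) J(h, g)^-1 w#hg.
   For g = g1^bm and for g = g2^bn the function J(g, _) is 1 and J(_, g) is a
   character of G.  Hence g is central iff chi_w(g) = J(deg w, g) for all w, and
   by multiplicativity it is enough to look at w = X_1, X_2, which are nonzero
   in B(V) as the Nichols ideal starts in degree 2. *)

(** * Linear maps out of a free module, given by their values on the basis *)

Section LinearExtension.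

Set Implicit Arguments.
Unset Strict Implicit.

Variables (k : fieldType) (K : choiceType) (U : lmodType k).

(** Comultiplications are studied below through their images under such extensions, with an
    arbitrary target [U]; this avoids comparing elements of tensor products of quotients. *)
Definition malg_lin (phi : K -> U) (x : {malg k[K]}) : U :=
  \sum_(w <- msupp x) x@_w *: phi w.

Lemma malg_linD phi : {morph malg_lin phi : x y / x + y}.
Proof.
exact: (malg_sumD (F := fun w c => c *: phi w) (fun w a b => scalerDl (phi w) a b)).
Qed.

Lemma malg_lin0 phi : malg_lin phi 0 = 0.
Proof. exact: (malg_sum0 (fun w c => c *: phi w)). Qed.

Lemma malg_linU phi c w : malg_lin phi << c *g w >> = c *: phi w.
Proof.
exact: (malg_sumU (F := fun w c => c *: phi w) c w (fun w => scale0r (phi w))).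
Qed.

Lemma eq_malg_lin phi psi : phi =1 psi -> malg_lin phi =1 malg_lin psi.
Proof. by move=> E x; apply: eq_bigr => w _; rewrite E. Qed.

(** The support of [c *: x] is empty when [c = 0], so both sides are summed over the support of
    [x]. *)
Lemma malg_linZ phi c x : malg_lin phi (c *: x) = c *: malg_lin phi x.
Proof.
rewrite /malg_lin (@malg_sumw k K U (fun w a => a *: phi w) (c *: x) (msupp x)).
- by rewrite scaler_sumr; apply: eq_bigr => w _; rewrite mcoeffZ scalerA.
- by move=> w; apply: scale0r.
- exact: msuppZ_le.
Qed.

Lemma malg_lin_sum_fun (J : Type) (r : seq J) (phi : J -> K -> U) x :
  malg_lin (fun w => \sum_(j <- r) phi j w) x = \sum_(j <- r) malg_lin (phi j) x.
Proof.
rewrite /malg_lin exchange_big /=; apply: eq_bigr => w _.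
by rewrite scaler_sumr.
Qed.

Lemma malg_lin_sumr (J : Type) (r : seq J) (F : J -> {malg k[K]}) phi :
  malg_lin phi (\sum_(j <- r) F j) = \sum_(j <- r) malg_lin phi (F j).
Proof. exact: (big_morph _ (malg_linD phi) (malg_lin0 phi)). Qed.

(** Serves to evaluate sums over the group at an element of the bosonization concentrated at a
    single [j]. *)
Lemma malg_lin_delta (J : finType) (phi : J -> K -> U) j x :
  \sum_i malg_lin (phi i) (if i == j then x else 0) = malg_lin (phi j) x.
Proof.
rewrite (bigD1 j) //= eqxx big1 ?addr0 // => i /negPf->; exact: malg_lin0.
Qed.

Lemma malg_lin_delta1 (J : finType) (phi : J -> K -> U) j w :
  \sum_i malg_lin (phi i) (if i == j then << w >> else 0) = phi j w.
Proof. by rewrite malg_lin_delta malg_linU scale1r. Qed.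

(** The double sum has the shape of [braided_mul], with [c] the braiding scalar and [f] the
    componentwise product. *)
Lemma malg_lin_bilinear (K1 K2 : choiceType) (f : K1 -> K2 -> K) (c : K1 -> K2 -> k)
    phi (x : {malg k[K1]}) (y : {malg k[K2]}) :
  malg_lin phi (\sum_(p <- msupp x) \sum_(q <- msupp y)
    << x@_p * y@_q * c p q *g f p q >>) =
  \sum_(p <- msupp x) x@_p *: \sum_(q <- msupp y) y@_q *: (c p q *: phi (f p q)).
Proof.
rewrite malg_lin_sumr; apply: eq_bigr => p _.
rewrite malg_lin_sumr scaler_sumr; apply: eq_bigr => q _.
by rewrite malg_linU !scalerA.
Qed.

End LinearExtension.

(** * Words, their comultiplication in the tensor algebra, and the counit laws there *)

Section Counits.

Set Implicit Arguments.
Unset Strict Implicit.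

Variables (k : fieldType) (gT : finGroupType) (I : choiceType).
Variable V : I -> yd1 k gT.
Local Notation word := (fmonom I).
Local Notation T := {malg k[fmonom I]}.
Local Notation TT := {malg k[(fmonom I * fmonom I)%type]}.

Lemma word_deg1 : word_deg V mone = 1%g.
Proof. by rewrite /word_deg fm1 big_nil. Qed.

Lemma word_char1 g : word_char V mone g = 1.
Proof. by rewrite /word_char fm1 big_nil. Qed.

Lemma word_charU i g : word_char V (fmu i) g = yd_char (V i) g.
Proof. by rewrite /word_char fmU big_seq1. Qed.

Lemma word_degU i : word_deg V (fmu i) = yd_deg (V i).
Proof. by rewrite /word_deg fmU big_seq1. Qed.

Lemma word_char_g1 w : word_char V w 1%g = 1.
Proof. by rewrite /word_char big1 // => i _; apply: yd_char1. Qed.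

Lemma word_ind (P : word -> Prop) :
  P mone -> (forall i w, P w -> P (mmul (fmu i) w)) -> forall w, P w.
Proof.
move=> P1 PM [s]; elim: s => [|i s IHs].
  by have <- : mone = FMonom [::] :> word by apply: val_inj; rewrite /= fm1.
have -> : FMonom (i :: s) = mmul (fmu i) (FMonom s) :> word.
  by apply: val_inj; rewrite /= fmM fmU.
exact: PM.
Qed.

Lemma word_comul1 : word_comul V mone = << (mone, mone) >>.
Proof. by rewrite /word_comul fm1. Qed.

Lemma malg_lin_braided_mul (U : lmodType k) (phi : word * word -> U) (x y : TT) :
  malg_lin phi (braided_mul V x y) =
  malg_lin (fun p : word * word => malg_lin (fun q : word * word =>
    word_char V q.1 (word_deg V p.2) *: phi (mmul p.1 q.1, mmul p.2 q.2)) y) x.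
Proof.
exact: (malg_lin_bilinear (fun p q => (mmul p.1 q.1, mmul p.2 q.2))
  (fun p q => word_char V q.1 (word_deg V p.2)) phi x y).
Qed.

(* Stated for variables u and e because fmu and mone inside a pair make type
   inference pick other (convertible) choiceType instances, on which rewriting
   does not terminate in reasonable time. *)
Lemma word_comulM i w (u e : word) : u = fmu i -> e = mone ->
  word_comul V (mmul u w) = braided_mul V (<< (u, e) >> + << (e, u) >>) (word_comul V w).
Proof. by move=> -> ->; rewrite /word_comul fmM fmU. Qed.

(** The comultiplication of [w] is multiplied on the left by X_i (x) 1 + 1 (x) X_i. The first
    summand braids trivially, as the empty word has degree [1]; in the second, X_i crosses the left
    factor [q.1], which costs the character of [q.1] at [yd_deg (V i)]. *)
Lemma malg_lin_comulM (U : lmodType k) (phi : word * word -> U) i w :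
  malg_lin phi (word_comul V (mmul (fmu i) w)) =
  malg_lin (fun q : word * word => phi (mmul (fmu i) q.1, q.2) +
    word_char V q.1 (yd_deg (V i)) *: phi (q.1, mmul (fmu i) q.2))
    (word_comul V w).
Proof.
have [u uE] : exists u : word, u = fmu i by exists (fmu i).
have [e eE] : exists e : word, e = mone by exists mone.
rewrite -uE (word_comulM w uE eE); move: (word_comul V w) => y.
rewrite malg_lin_braided_mul; set psi := fun p => _; rewrite malg_linD.
rewrite [X in X + _](malg_linU psi 1 (u, e)) [X in _ + X](malg_linU psi 1 (e, u)).
rewrite !scale1r -big_split /psi /=.
apply: eq_bigr => q _; rewrite -scalerDr uE eE.
by rewrite !mul1m word_deg1 word_char_g1 word_degU scale1r.
Qed.

(** Induction on the word: of the two terms in [malg_lin_comulM], the second has a nonempty right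
    factor and is killed by the counit. *)
Lemma word_counitr (U : lmodType k) (phi : word -> U) w :
  malg_lin (fun p : word * word => (p.2 == mone)%:R *: phi p.1) (word_comul V w) = phi w.
Proof.
elim/word_ind: w phi => [|i w IHw] phi.
  by rewrite word_comul1 malg_linU /= eqxx !scale1r.
rewrite malg_lin_comulM -(IHw (fun u => phi (mmul (fmu i) u))).
apply: eq_malg_lin => q /=.
by rewrite fmM_eq1 fm1_eq1 scale0r scaler0 addr0.
Qed.

(** Here the first term is killed, and the second survives only for [q.1 = mone], where the braiding
    scalar is [1]. *)
Lemma word_counitl (U : lmodType k) (phi : word -> U) w :
  malg_lin (fun p : word * word => (p.1 == mone)%:R *: phi p.2) (word_comul V w) = phi w.
Proof.
elim/word_ind: w phi => [|i w IHw] phi.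
  by rewrite word_comul1 malg_linU /= eqxx !scale1r.
rewrite malg_lin_comulM -(IHw (fun u => phi (mmul (fmu i) u))).
apply: eq_malg_lin => q /=; rewrite fmM_eq1 fm1_eq1 scale0r add0r.
by case: eqP => [->|_]; rewrite ?word_char1 ?scale1r ?scale0r ?scaler0.
Qed.

Lemma malg_lin_comul (U : lmodType k) (phi : word * word -> U) x :
  malg_lin phi (tensor_comul V x) =
  malg_lin (fun w : word => malg_lin phi (word_comul V w)) x.
Proof.
rewrite /tensor_comul (big_morph _ (malg_linD phi) (malg_lin0 phi)).
by apply: eq_bigr => w _; rewrite malg_linZ.
Qed.

(** * The counit laws in the Nichols algebra, with the coaction on the right tensor factor *)

Lemma nichols_counitU w : nichols_counit (nichols_pi V << w >>) = (w == mone)%:R.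
Proof. by rewrite nichols_counit_pi mcoeffU1. Qed.

Lemma nichols_pi_linear c (x y : T) :
  nichols_pi V (c *: x + y) = c *: nichols_pi V x + nichols_pi V y.
Proof. by rewrite raddfD /= -nichols_pi_scale. Qed.

Lemma nichols_counit_scalar : scalar (@nichols_counit k gT I V).
Proof.
move=> c; elim/nichols_ind => x; elim/nichols_ind => y.
by rewrite -nichols_pi_linear !nichols_counit_pi mcoeffD mcoeffZ.
Qed.

Lemma nichols_counitD : {morph @nichols_counit k gT I V : x y / x + y}.
Proof. by move=> x y; have := nichols_counit_scalar 1 x y; rewrite scale1r mul1r. Qed.

Lemma nichols_counit0 : nichols_counit (0 : nichols V) = 0.
Proof.
by apply: (addrI (nichols_counit (0 : nichols V))); rewrite -nichols_counitD !addr0.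
Qed.

Lemma nichols_piU c w : nichols_pi V << c *g w >> = c *: nichols_pi V << w >>.
Proof. by rewrite [RHS]nichols_pi_scale malg_scaleU mulr1. Qed.

(** The counit leaves only the empty word on the right, and its coaction contributes the group
    element [1]. *)
Lemma nichols_comul_counitr (U : lmodType k) (H : nichols V -> gT -> U) x :
  (forall h, linear (H^~ h)) ->
  \sum_(p <- nichols_comul x) nichols_counit p.2 *: H p.1.1 p.1.2 = H x 1%g.
Proof.
move=> Hl; elim/nichols_ind: x => x.
rewrite (@nichols_comul_pi _ _ _ V U (fun r h s => nichols_counit s *: H r h)).
- transitivity (malg_lin (fun p : word * word => (p.2 == mone)%:R *:
      H (nichols_pi V << p.1 >>) 1%g) (tensor_comul V x)).
    apply: eq_bigr => p _; rewrite nichols_counitU.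
    by case: eqP => [->|]; rewrite ?word_deg1 ?scale0r.
  rewrite malg_lin_comul.
  rewrite (eq_malg_lin (psi := fun w => H (nichols_pi V << w >>) 1%g)); last first.
    by move=> w; apply: (word_counitr (fun u => H (nichols_pi V << u >>) 1%g)).
  have HD : {morph H^~ 1%g : a b / a + b}.
    by move=> a b; have := Hl 1%g 1 a b; rewrite !scale1r.
  have H0 : H 0 1%g = 0 by apply: (addrI (H 0 1%g)); rewrite -HD !addr0.
  rewrite [in RHS](monalgE x) raddf_sum /= (big_morph _ HD H0).
  apply: eq_bigr => w _; rewrite nichols_piU.
  by have := Hl 1%g x@_w (nichols_pi V << w >>) 0; rewrite !addr0 H0 addr0.
- by move=> h s c a b; rewrite Hl scalerDr !scalerA mulrC.
- by move=> r h c a b; rewrite nichols_counit_scalar scalerDl scalerA.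
Qed.

(** The left factor must be the empty word, so the right one is the whole word and its coaction
    contributes [word_deg V w]. This varies with the word, hence the sum over the words of a
    representative [x]. *)
Lemma nichols_comul_counitl (U : lmodType k) (H : gT -> nichols V -> U) x :
  (forall h, linear (H h)) ->
  \sum_(p <- nichols_comul (nichols_pi V x)) nichols_counit p.1.1 *: H p.1.2 p.2
  = malg_lin (fun w => H (word_deg V w) (nichols_pi V << w >>)) x.
Proof.
move=> Hl.
rewrite (@nichols_comul_pi _ _ _ V U (fun r h s => nichols_counit r *: H h s)).
- transitivity (malg_lin (fun p : word * word => (p.1 == mone)%:R *:
      H (word_deg V p.2) (nichols_pi V << p.2 >>)) (tensor_comul V x)).
    by apply: eq_bigr => p _; rewrite nichols_counitU.
  rewrite malg_lin_comul; apply: eq_malg_lin => w.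
  exact: (word_counitl (fun u => H (word_deg V u) (nichols_pi V << u >>))).
- by move=> h s c a b; rewrite nichols_counit_scalar scalerDl scalerA.
- by move=> r h c a b; rewrite Hl scalerDr !scalerA mulrC.
Qed.

(* The linear extension of a function on G to B(V)#kG, by zero in positive
   degree. *)
Definition deg0_ext (A : gT -> k) (y : bosonization V) : k :=
  \sum_g nichols_counit (y g) * A g.

(** * Contraction of the outer factors of the comultiplication of the bosonization with functions on
    the group *)

Lemma deg0_ext_smash A r h : deg0_ext A (smash r h) = nichols_counit r * A h.
Proof.
rewrite /deg0_ext (bigD1 h) //= ffunE eqxx big1 ?addr0 // => g /negPf gh.
by rewrite ffunE gh nichols_counit0 mul0r.
Qed.

Lemma smash_linear h : linear ((@smash _ _ _ V)^~ h).
Proof.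
move=> c x y; apply/ffunP => g; rewrite !ffunE.
by case: eqP; rewrite // scaler0 addr0.
Qed.

Lemma smashZ c (r : nichols V) h : smash (c *: r) h = c *: smash r h.
Proof. by apply/ffunP => g; rewrite !ffunE; case: eqP; rewrite // scaler0. Qed.

Lemma boson_comul_deg0r (U : lmodType k) (C : gT -> k) (L : bosonization V -> U) x :
  linear L ->
  \sum_(p <- boson_comul x) deg0_ext C p.2 *: L p.1 =
  \sum_h C h *: L (smash (x h) h).
Proof.
move=> Ll; rewrite big_allpairs_dep /= big_enum /=; apply: eq_bigr => h _.
transitivity (\sum_(p <- nichols_comul (x h)) nichols_counit p.2 *:
  (C h *: L (smash p.1.1 (p.1.2 * h)%g))).
  by apply: eq_bigr => p _; rewrite deg0_ext_smash scalerA.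
rewrite (nichols_comul_counitr (H := fun r g => C h *: L (smash r (g * h)%g))).
  by rewrite mul1g.
by move=> g c a b; rewrite smash_linear Ll scalerDr !scalerA mulrC.
Qed.

Lemma boson_comul_deg0l (U : lmodType k) (A : gT -> k) (L : bosonization V -> U)
    (x : bosonization V) (t : gT -> T) :
  linear L -> (forall h, x h = nichols_pi V (t h)) ->
  \sum_(p <- boson_comul x) deg0_ext A p.1 *: L p.2 =
  \sum_h malg_lin (fun w => A (word_deg V w * h)%g *:
    L (smash (nichols_pi V << w >>) h)) (t h).
Proof.
move=> Ll xE; rewrite big_allpairs_dep /= big_enum /=; apply: eq_bigr => h _.
transitivity (\sum_(p <- nichols_comul (x h)) nichols_counit p.1.1 *:
  (A (p.1.2 * h)%g *: L (smash p.2 h))).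
  by apply: eq_bigr => p _; rewrite deg0_ext_smash scalerA.
rewrite xE.
rewrite (nichols_comul_counitl (H := fun g r => A (g * h)%g *: L (smash r h))) //.
by move=> g c a b; rewrite smash_linear Ll scalerDr !scalerA mulrC.
Qed.

(** Contracting the leftmost factor by [A] gives a linear map [M] on the left factor of the outer
    comultiplication; the right counit law then applies to [M]. The degree of the word shifts the
    argument of [A] but not that of [C], because the coaction of the right factor multiplies the
    group element on the left. *)
Lemma boson_comul2_deg0 (U : lmodType k) (A C : gT -> k)
    (L : bosonization V -> U) (x : bosonization V) (t : gT -> T) :
  linear L -> (forall h, x h = nichols_pi V (t h)) ->
  \sum_(p <- boson_comul2 x) (deg0_ext A p.1.1 * deg0_ext C p.2) *: L p.1.2 =
  \sum_h malg_lin (fun w => (A (word_deg V w * h)%g * C h) *: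
    L (smash (nichols_pi V << w >>) h)) (t h).
Proof.
move=> Ll xE; rewrite big_allpairs_dep /=.
pose M y := \sum_(p <- boson_comul y) deg0_ext A p.1 *: L p.2.
have ME (y : bosonization V) (s : gT -> T) : (forall h, y h = nichols_pi V (s h)) -> M y =
    \sum_h malg_lin (fun w => A (word_deg V w * h)%g *:
    L (smash (nichols_pi V << w >>) h)) (s h).
  exact: boson_comul_deg0l.
(* [ME] holds for any choice of representatives, so those of a linear combination can be taken to be
   the same combination of representatives. *)
have Ml : linear M.
  move=> c y z.
  rewrite (ME y (fun h => repr (y h))) => [|h]; last by rewrite nichols_reprK.
  rewrite (ME z (fun h => repr (z h))) => [|h]; last by rewrite nichols_reprK.
  rewrite (ME _ (fun h => c *: repr (y h) + repr (z h))) => [|h]; last first.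
    by rewrite !ffunE raddfD /= nichols_reprK.
  rewrite scaler_sumr -big_split; apply: eq_bigr => h _.
  by rewrite malg_linD malg_linZ.
transitivity (\sum_(p <- boson_comul x) deg0_ext C p.2 *: M p.1).
  apply: eq_bigr => p _; rewrite scaler_sumr; apply: eq_bigr => q _.
  by rewrite scalerA mulrC.
rewrite boson_comul_deg0r //; apply: eq_bigr => h _.
rewrite (ME _ (fun g => if g == h then t h else 0)) => [|g]; last first.
  by rewrite ffunE; case: eqP => _; rewrite ?xE ?raddf0.
rewrite malg_lin_delta /malg_lin scaler_sumr; apply: eq_bigr => w _.
by rewrite !scalerA -mulrA mulrC mulrA.
Qed.

(** * The action on words and the bilinearity of the product of the bosonization *)

Lemma tensor_act_mcoeff g (x : T) w :
  (tensor_act V g x)@_w = x@_w * word_char V w g.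
Proof.
rewrite /tensor_act raddf_sum /=.
transitivity (\sum_(v <- msupp x) (x@_v * word_char V v g) *+ (v == w)).
  by apply: eq_bigr => v _; rewrite mcoeffU.
case: (msuppP x w) => [xw|xw]; last first.
  by rewrite mul0r big_seq big1 // => v vx; case: eqP vx xw => // -> ->.
rewrite (bigD1_seq w) ?fset_uniq //= eqxx big1 ?addr0 // => v /negPf->.
by rewrite mulr0n.
Qed.

Lemma nichols_act_linear g : linear (@nichols_act k gT I V g).
Proof.
move=> c; elim/nichols_ind => x; elim/nichols_ind => y.
rewrite -nichols_pi_linear !nichols_act_pi -nichols_pi_linear.
apply: congr1; apply/malgP => w.
rewrite [LHS]tensor_act_mcoeff [RHS]mcoeffD [X in X * _ = _]mcoeffD.
rewrite [X in _ = X + _]mcoeffZ [X in (X + _) * _ = _]mcoeffZ !tensor_act_mcoeff.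
by rewrite mulrDl mulrA.
Qed.

Lemma nichols_actU g w :
  nichols_act g (nichols_pi V << w >>) = word_char V w g *: nichols_pi V << w >>.
Proof.
rewrite nichols_act_pi -nichols_piU; apply: congr1; apply/malgP => v.
by rewrite tensor_act_mcoeff !mcoeffU; case: eqP => [->|_]; rewrite ?mul1r ?mul0r.
Qed.

Lemma nichols_act0 g : nichols_act g (0 : nichols V) = 0.
Proof.
have := nichols_act_linear g (-1) 0 0.
by rewrite !scaleN1r oppr0 !add0r addNr.
Qed.

Lemma boson_mul_smash (r s : nichols V) g h :
  boson_mul (smash r g) (smash s h) = smash (r * nichols_act g s) (g * h)%g.
Proof.
have smash0 f : smash (0 : nichols V) f = 0.
  by apply/ffunP => f'; rewrite !ffunE if_same.
rewrite /boson_mul (bigD1 g) //= [X in _ + X]big1 => [|g' /negPf gg]; last first.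
  by rewrite big1 // => h' _; rewrite ffunE gg mul0r smash0.
rewrite (bigD1 h) //= [X in _ + X + _]big1 => [|h' /negPf hh]; last first.
  by rewrite !ffunE hh nichols_act0 mulr0 smash0.
by rewrite !ffunE !eqxx !addr0.
Qed.

Lemma boson_linearE c (x y : bosonization V) h : (c *: x + y) h = c *: x h + y h.
Proof. by rewrite !ffunE. Qed.

Lemma boson_mul_linearr (x : bosonization V) : linear (boson_mul x).
Proof.
move=> c y z; rewrite /boson_mul !scaler_sumr -big_split; apply: eq_bigr => g _.
rewrite scaler_sumr -big_split; apply: eq_bigr => h _ /=.
by rewrite boson_linearE (nichols_act_linear g c) mulrDr -[X in smash (X + _)]scalerAr
  smash_linear.
Qed.

Lemma boson_mul_linearl (y : bosonization V) : linear (@boson_mul _ _ _ V ^~ y).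
Proof.
move=> c x z; rewrite /boson_mul !scaler_sumr -big_split; apply: eq_bigr => g _.
rewrite scaler_sumr -big_split; apply: eq_bigr => h _ /=.
by rewrite boson_linearE mulrDl -[X in smash (X + _)]scalerAl smash_linear.
Qed.

(** * The twisted product, in general and with a group-like factor *)

Lemma boson_extE F (x y : bosonization V) :
  boson_ext F x y = deg0_ext (fun h => deg0_ext (F^~ h) x) y.
Proof.
rewrite /boson_ext exchange_big /=; apply: eq_bigr => h _.
by rewrite mulr_sumr; apply: eq_bigr => g _; rewrite mulrAC mulrA mulrC mulrA.
Qed.

(** [boson_comul2_deg0] is applied first to [y], for each term of the comultiplication of [x], and
    then to [x]. The representatives [s] and [t] are left free so that single words can be inserted
    later. *)
Lemma twisted_mulE F (x y : bosonization V) (s t : gT -> T) :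
  (forall h, x h = nichols_pi V (s h)) -> (forall h, y h = nichols_pi V (t h)) ->
  twisted_mul F x y =
  \sum_h malg_lin (fun v => \sum_g malg_lin (fun u =>
    (F (word_deg V u * g)%g (word_deg V v * h)%g * (F g h)^-1) *:
    smash (nichols_pi V << u >> * nichols_act g (nichols_pi V << v >>))
      (g * h)%g) (s g)) (t h).
Proof.
move=> xE yE; rewrite /twisted_mul.
transitivity (\sum_(p <- boson_comul2 x) \sum_h malg_lin (fun v =>
  (deg0_ext (F^~ (word_deg V v * h)%g) p.1.1 *
   deg0_ext (fun g => (F g h)^-1) p.2) *:
  boson_mul p.1.2 (smash (nichols_pi V << v >>) h)) (t h)).
  apply: eq_bigr => p _.
  rewrite -(boson_comul2_deg0 (fun h => deg0_ext (F^~ h) p.1.1)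
    (fun h => deg0_ext (fun g => (F g h)^-1) p.2) (boson_mul_linearr p.1.2) yE).
  by apply: eq_bigr => q _; rewrite !boson_extE.
rewrite exchange_big /=; apply: eq_bigr => h _; rewrite -malg_lin_sum_fun.
apply: eq_malg_lin => v.
rewrite (boson_comul2_deg0 _ _
  (boson_mul_linearl (smash (nichols_pi V << v >>) h)) xE).
by apply: eq_bigr => g _; apply: eq_malg_lin => u; rewrite boson_mul_smash.
Qed.

Lemma smash_piE w g h :
  smash (nichols_pi V << w >>) g h = nichols_pi V (if h == g then << w >> else 0).
Proof. by rewrite ffunE; case: eqP => // _; rewrite raddf0. Qed.

Lemma twisted_mul_grouplikel F g (x : bosonization V) (t : gT -> T) :
  (forall h, x h = nichols_pi V (t h)) ->
  twisted_mul F (smash 1 g) x =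
  \sum_h malg_lin (fun v =>
    (F g (word_deg V v * h)%g * (F g h)^-1 * word_char V v g) *:
    smash (nichols_pi V << v >>) (g * h)%g) (t h).
Proof.
(* The unit of the Nichols algebra is the class of the empty word, so [smash_piE mone g] provides a
   representative of [smash 1 g]. *)
move=> xE; rewrite (twisted_mulE F (smash_piE mone g) xE); apply: eq_bigr => h _.
apply: eq_malg_lin => v; rewrite malg_lin_delta1 word_deg1 mul1g mul1r.
by rewrite nichols_actU smashZ scalerA.
Qed.

Lemma twisted_mul_groupliker F g (x : bosonization V) (t : gT -> T) :
  (forall h, x h = nichols_pi V (t h)) ->
  twisted_mul F x (smash 1 g) =
  \sum_h malg_lin (fun v =>
    (F (word_deg V v * h)%g g * (F h g)^-1) *:
    smash (nichols_pi V << v >>) (h * g)%g) (t h).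
Proof.
move=> xE; rewrite (twisted_mulE F xE (smash_piE mone g)).
rewrite malg_lin_delta1; apply: eq_bigr => h _.
apply: eq_malg_lin => v; rewrite word_deg1 mul1g.
by rewrite nichols_actU word_char1 scale1r mulr1.
Qed.

Lemma twisted_mul_grouplikelU F g h w :
  twisted_mul F (smash 1 g) (smash (nichols_pi V << w >>) h) =
  (F g (word_deg V w * h)%g * (F g h)^-1 * word_char V w g) *:
    smash (nichols_pi V << w >>) (g * h)%g.
Proof.
exact: etrans (twisted_mul_grouplikel F g (smash_piE w h)) (malg_lin_delta1 _ h w).
Qed.

Lemma twisted_mul_grouplikerU F g h w :
  twisted_mul F (smash (nichols_pi V << w >>) h) (smash 1 g) =
  (F (word_deg V w * h)%g g * (F h g)^-1) *: smash (nichols_pi V << w >>) (h * g)%g.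
Proof.
exact: etrans (twisted_mul_groupliker F g (smash_piE w h)) (malg_lin_delta1 _ h w).
Qed.

(** * Centrality of a group-like element *)

Lemma nichols_pi_letter_inj i : injective (fun c : k => c *: nichols_pi V << fmu i >>).
Proof.
move=> a b /= /eqP; rewrite -!nichols_piU => /nichols_piP H.
(* A letter has degree 1, where elements of the Nichols ideal have coefficient zero. *)
have := in_nichols_ideal_ge2 (w := fmu i) H; rewrite fdegU => /(_ isT) /eqP.
by rewrite mcoeffB !mcoeffUU subr_eq0 => /eqP.
Qed.

(** Triviality of [F g] removes both values of [F] from the product with [g] on the left;
    multiplicativity of [F^~ g] cancels [h] from the product with [g] on the right. Commutativity of
    the group makes both products lie over the same group element. *)
Lemma in_twisted_center_grouplike (F : gT -> gT -> k) g :
  abelian [set: gT] -> (forall h, F g h = 1) ->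
  {morph F^~ g : x y / (x * y)%g >-> x * y} -> (forall h, F h g != 0) ->
  in_twisted_center F (smash (1 : nichols V) g) <->
  forall i, yd_char (V i) g = F (yd_deg (V i)) g.
Proof.
move=> abG Fg FM F0.
have GC x y : (x * y = y * x :> gT)%g by apply: (centsP abG); rewrite inE.
have F1 : F 1%g g = 1.
  by apply: (mulfI (F0 1%g)); rewrite -FM mulg1 mulr1.
split=> [Hc i | Hc x].
  (* Testing against X_i # 1 and reading the component at [g] gives two multiples of X_i to
     compare. *)
  have := Hc (smash (nichols_pi V << fmu i >>) 1%g).
  rewrite twisted_mul_grouplikelU twisted_mul_grouplikerU word_charU word_degU.
  rewrite !Fg !mulg1 mul1g F1 invr1 !mulr1 mul1r.
  move=> /(congr1 (fun f : bosonization V => f g)); rewrite !ffunE eqxx => E.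
  exact: (nichols_pi_letter_inj E).
(* Both sides are multiplicative in the word, so agreement on letters suffices. *)
have Hw w : word_char V w g = F (word_deg V w) g.
  elim/word_ind: w => [|i w IHw]; first by rewrite word_char1 word_deg1 F1.
  rewrite /word_char /word_deg fmM fmU /= !big_cons FM.
  by rewrite -/(word_char V w g) -/(word_deg V w) Hc IHw.
have xE h : x h = nichols_pi V (repr (x h)) by rewrite nichols_reprK.
rewrite (twisted_mul_grouplikel _ _ xE) (twisted_mul_groupliker _ _ xE).
apply: eq_bigr => h _; apply: eq_malg_lin => w.
by rewrite (GC g h) !Fg Hw FM invr1 !mul1r mulfK.
Qed.

End Counits.

(** * Coordinates in the direct product of the two cyclic groups *)

Section Exponents.

Set Implicit Arguments.
Unset Strict Implicit.

Variables (gT : finGroupType) (g1 g2 : gT).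
Hypothesis gT_dprod : (<[g1]> \x <[g2]>)%g = [set: gT].

Lemma dprod_cycles_abelian : abelian [set: gT].
Proof.
by have [_ <- c12 _] := dprodP gT_dprod; rewrite abelianM !cycle_abelian.
Qed.

Lemma dprod_cyclesP h : exists x1 x2, h = (g1 ^+ x1 * g2 ^+ x2)%g.
Proof.
have [|x [y [/cycleP[i ->] /cycleP[j ->] -> _]]] := mem_dprod gT_dprod (x := h).
  by rewrite inE.
by exists i, j.
Qed.

Lemma dprod_cyclesM x1 x2 y1 y2 :
  (g1 ^+ x1 * g2 ^+ x2 * (g1 ^+ y1 * g2 ^+ y2) = g1 ^+ (x1 + y1) * g2 ^+ (x2 + y2))%g.
Proof.
have C (x y : gT) : commute x y by apply: (centsP dprod_cycles_abelian); rewrite inE.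
by rewrite !expgD !mulgA; congr (_ * _)%g; rewrite -!mulgA (C (g2 ^+ x2)%g).
Qed.

(** The pair of remainders shows that [pick] succeeds, so the default value does not occur; the pair
    found equals it because the two cycles meet trivially. *)
Lemma exponentsE x1 x2 :
  exponents g1 g2 (g1 ^+ x1 * g2 ^+ x2)%g = (x1 %% #[g1], x2 %% #[g2])%g%N.
Proof.
have [_ _ _ tI] := dprodP gT_dprod.
pose i1 := Ordinal (ltn_pmod x1 (order_gt0 g1)).
pose i2 := Ordinal (ltn_pmod x2 (order_gt0 g2)).
rewrite /exponents; case: pickP => [[/= i j] /eqP E|/(_ (i1, i2))]; last first.
  by rewrite /= !expg_mod_order eqxx.
(* Powers of [g1] on one side and of [g2] on the other: the common value lies in both cycles. *)
have E1 : (g1 ^- i * g1 ^+ x1 = g2 ^+ j * g2 ^- x2)%g.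
  apply: (mulgI (g1 ^+ i)%g); rewrite mulKVg; apply: (mulIg (g2 ^+ x2)%g).
  by rewrite E mulgA mulgKV.
have : (g1 ^- i * g1 ^+ x1)%g \in (<[g1]> :&: <[g2]>)%g.
  by rewrite inE {2}E1 !groupM ?groupV ?mem_cycle.
rewrite tI inE => /eqP E0; move: E1; rewrite E0 => /esym/eqP.
rewrite -eq_mulgV1 eq_expg_mod_order => /eqP; rewrite modn_small // => ->.
move/eqP: E0; rewrite -eq_mulVg1 eq_expg_mod_order => /eqP.
by rewrite modn_small // => ->.
Qed.

End Exponents.

(** * Values of J when one argument is [g1 ^+ bm] or [g2 ^+ bn] *)

Section Twist.

Set Implicit Arguments.
Unset Strict Implicit.

Variables (k : fieldType) (bm bn : nat) (zeta : nat -> k).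
Hypotheses (bm_gt0 : (0 < bm)%N) (bn_gt0 : (0 < bn)%N).
Hypothesis zeta_prim : forall N, (0 < N)%N -> N.-primitive_root (zeta N).
Hypothesis zeta_m : zeta (bm ^ 2)%N ^+ bm = zeta bm.
Hypothesis zeta_n : zeta (bn ^ 2)%N ^+ bn = zeta bn.
Hypothesis zeta_mn_n : zeta (bm * bn)%N ^+ bm = zeta bn.

Variables (gT : finGroupType) (g1 g2 : gT).
Hypotheses (g1_order : #[g1]%g = (bm ^ 2)%N) (g2_order : #[g2]%g = (bn ^ 2)%N).
Hypothesis gT_dprod : (<[g1]> \x <[g2]>)%g = [set: gT].
Variables (a b d : nat).
Hypotheses (a_lt : (a < bm)%N) (b_lt : (b < bm)%N) (d_lt : (d < bn)%N).

Local Notation J := (Jabd g1 g2 zeta bm bn a b d).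

Lemma zetaX N : (0 < N)%N -> zeta N ^+ N = 1.
Proof. by move=> N0; apply: prim_expr_order; apply: zeta_prim. Qed.

Lemma expr_dvdn (z : k) (N x : nat) : z ^+ N = 1 -> (N %| x)%N -> z ^+ x = 1.
Proof. by move=> zN /dvdnP[y ->]; rewrite mulnC exprM zN expr1n. Qed.

(** The factor [c] of the exponent turns [z] into [z ^+ c], so a reduction modulo [N] is harmless as
    soon as [N] kills [z ^+ c], even if it does not kill [z]. *)
Lemma expr_mulmod (z : k) (N c e x : nat) : (z ^+ c) ^+ N = 1 ->
  z ^+ (e * (x %% N) * c) = z ^+ (e * x * c).
Proof.
by move=> zN; rewrite -!mulnA !(mulnC e) !(mulnC _ c) !exprM expr_mod.
Qed.

Lemma dvdn_subn_mod (x N : nat) : (N %| x - x %% N)%N.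
Proof. by rewrite {1}(divn_eq x N) addnK dvdn_mull. Qed.

(** For positive [N], this is the reduced exponent of an [N]-th power in a cycle of order [N ^ 2]:
    [N] itself, or 0 when [N = 1]. *)
Lemma dvdn_mod_sqr N : (N %| N %% N ^ 2)%N.
Proof. by rewrite /dvdn modn_dvdm ?modnn // dvdn_exp. Qed.

Lemma JabdE x1 x2 y1 y2 : J (g1 ^+ x1 * g2 ^+ x2)%g (g1 ^+ y1 * g2 ^+ y2)%g =
  zeta (bm ^ 2)%N ^+ (a * (x1 %% bm ^ 2) * (y1 %% bm ^ 2 - y1 %% bm))
  * zeta (bm * bn)%N ^+ (b * (x2 %% bn ^ 2) * (y1 %% bm ^ 2 - y1 %% bm))
  * zeta (bn ^ 2)%N ^+ (d * (x2 %% bn ^ 2) * (y2 %% bn ^ 2 - y2 %% bn)).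
Proof.
rewrite /Jabd !(exponentsE gT_dprod) /= g1_order g2_order.
by rewrite !modn_dvdm ?dvdn_exp.
Qed.

(* For bm = 1 the exponent of g1 in g1 ^+ bm is 0 and not bm, but then a = b = 0. *)
Lemma Jabd_g1r x1 x2 : J (g1 ^+ x1 * g2 ^+ x2)%g (g1 ^+ bm)%g =
  zeta (bm ^ 2)%N ^+ (a * x1 * bm) * zeta (bm * bn)%N ^+ (b * x2 * bm).
Proof.
rewrite -[(g1 ^+ bm)%g]mulg1 -(expg0 g2) JabdE mod0n !muln0 mulr1.
have [bm1|bm1] := leqP bm 1.
  move: a_lt b_lt; have -> : bm = 1%N by apply/eqP; rewrite eqn_leq bm1.
  by case: a b => [|//] [|//]; rewrite !mul0n.
rewrite modnn subn0 (@modn_small bm) -?mulnn ?ltn_Pmulr // mulnn.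
(* With [c = bm] the relevant powers are [zeta bm] and [zeta bn], killed by [bm ^ 2] and [bn ^ 2]
   respectively. *)
by rewrite !expr_mulmod ?zeta_m ?zeta_mn_n // -?mulnn exprM zetaX ?expr1n.
Qed.

Lemma Jabd_g2r x1 x2 : J (g1 ^+ x1 * g2 ^+ x2)%g (g2 ^+ bn)%g =
  zeta (bn ^ 2)%N ^+ (d * x2 * bn).
Proof.
rewrite -[(g2 ^+ bn)%g]mul1g -(expg0 g1) JabdE mod0n !muln0 !mul1r.
have [bn1|bn1] := leqP bn 1.
  (* When [bn = 1], the reduced exponent of [g2 ^+ bn] is 0 and not [bn], but [d = 0]. *)
  move: d_lt; have -> : bn = 1%N by apply/eqP; rewrite eqn_leq bn1.
  by case: d => [|//]; rewrite !mul0n.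
rewrite modnn subn0 (@modn_small bn) -?mulnn ?ltn_Pmulr // mulnn.
by rewrite expr_mulmod ?zeta_n // -?mulnn exprM zetaX ?expr1n.
Qed.

(** Only the first factor of J remains. Its exponent has one factor [bm] from the first argument and
    another from the difference [y1 - y1 %% bm]. *)
Lemma Jabd_g1l h : J (g1 ^+ bm)%g h = 1.
Proof.
have [y1 [y2 ->]] := dprod_cyclesP gT_dprod h.
rewrite -[(g1 ^+ bm)%g]mulg1 -(expg0 g2) JabdE mod0n !muln0 !mul0n !mulr1.
have -> : (y1 %% bm = y1 %% bm ^ 2 %% bm)%N by rewrite modn_dvdm ?dvdn_exp.
rewrite (expr_dvdn (zetaX _)) ?expn_gt0 ?bm_gt0 // -mulnn.
by rewrite dvdn_mul ?dvdn_mull ?mulnn ?dvdn_mod_sqr ?dvdn_subn_mod.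
Qed.

(** The first argument contributes [bn] to both remaining exponents; the differences contribute [bm]
    for the root of order [bm * bn] and [bn] for the root of order [bn ^ 2]. *)
Lemma Jabd_g2l h : J (g2 ^+ bn)%g h = 1.
Proof.
have [y1 [y2 ->]] := dprod_cyclesP gT_dprod h.
rewrite -[(g2 ^+ bn)%g]mul1g -(expg0 g1) JabdE mod0n !muln0 !mul0n !mul1r.
have -> : (y1 %% bm = y1 %% bm ^ 2 %% bm)%N by rewrite modn_dvdm ?dvdn_exp.
have -> : (y2 %% bn = y2 %% bn ^ 2 %% bn)%N by rewrite modn_dvdm ?dvdn_exp.
rewrite (expr_dvdn (zetaX _)) ?muln_gt0 ?bm_gt0 //; last first.
  by rewrite mulnC dvdn_mul ?dvdn_mull ?dvdn_mod_sqr ?dvdn_subn_mod.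
rewrite (expr_dvdn (zetaX _)) ?expn_gt0 ?bn_gt0 ?mulr1 // -mulnn.
by rewrite dvdn_mul ?dvdn_mull ?mulnn ?dvdn_mod_sqr ?dvdn_subn_mod.
Qed.

Lemma zetaX_neq0 N x : (0 < N)%N -> zeta N ^+ x != 0.
Proof.
move=> N0; apply: expf_neq0; apply/eqP => z0; have := zetaX N0.
by rewrite z0 expr0n gtn_eqF // => /esym/eqP; rewrite oner_eq0.
Qed.

Lemma in_twisted_center_g1 (I : choiceType) (V : I -> yd1 k gT) :
  in_twisted_center J (smash (1 : nichols V) (g1 ^+ bm)%g) <->
  forall i, yd_char (V i) (g1 ^+ bm)%g = J (yd_deg (V i)) (g1 ^+ bm)%g.
Proof.
apply: in_twisted_center_grouplike.
- exact: dprod_cycles_abelian gT_dprod.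
- exact: Jabd_g1l.
(* The closed form in [Jabd_g1r] is free of remainders, hence its exponents are additive in [x1] and
   [x2]. *)
- move=> x y.
  have [x1 [x2 ->]] := dprod_cyclesP gT_dprod x.
  have [y1 [y2 ->]] := dprod_cyclesP gT_dprod y.
  rewrite (dprod_cyclesM gT_dprod) !Jabd_g1r !mulnDr !mulnDl !exprD.
  by rewrite mulrACA.
- move=> x; have [x1 [x2 ->]] := dprod_cyclesP gT_dprod x.
  by rewrite Jabd_g1r mulf_neq0 ?zetaX_neq0 ?expn_gt0 ?muln_gt0 ?bm_gt0.
Qed.

Lemma in_twisted_center_g2 (I : choiceType) (V : I -> yd1 k gT) :
  in_twisted_center J (smash (1 : nichols V) (g2 ^+ bn)%g) <->
  forall i, yd_char (V i) (g2 ^+ bn)%g = J (yd_deg (V i)) (g2 ^+ bn)%g.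
Proof.
apply: in_twisted_center_grouplike.
- exact: dprod_cycles_abelian gT_dprod.
- exact: Jabd_g2l.
- move=> x y.
  have [x1 [x2 ->]] := dprod_cyclesP gT_dprod x.
  have [y1 [y2 ->]] := dprod_cyclesP gT_dprod y.
  by rewrite (dprod_cyclesM gT_dprod) !Jabd_g2r mulnDr mulnDl exprD.
- move=> x; have [x1 [x2 ->]] := dprod_cyclesP gT_dprod x.
  by rewrite Jabd_g2r zetaX_neq0 ?expn_gt0 ?bn_gt0.
Qed.

End Twist.

(** * Translation of centrality into the braiding matrix *)

Lemma yd_charX (k : fieldType) (gT : finGroupType) (W : yd1 k gT) g n :
  yd_char W (g ^+ n)%g = yd_char W g ^+ n.
Proof.
elim: n => [|n IHn]; first by rewrite expg0 yd_char1.
by rewrite expgS yd_charM IHn exprS.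
Qed.

Theorem proposition5p6
  (k : closedFieldType) (char0 : [pchar k] =i pred0)
  (bm bn m n : nat) (bm_gt0 : (0 < bm)%N) (bn_gt0 : (0 < bn)%N)
  (mE : m = (bm ^ 2)%N) (nE : n = (bn ^ 2)%N) (m_dvd_n : (m %| n)%N)
  (zeta : nat -> k)
  (zeta_prim : forall N, (0 < N)%N -> N.-primitive_root (zeta N))
  (zeta_m : zeta m ^+ bm = zeta bm)
  (zeta_mn_m : zeta (bm * bn)%N ^+ bn = zeta bm)
  (zeta_n : zeta n ^+ bn = zeta bn)
  (zeta_mn_n : zeta (bm * bn)%N ^+ bm = zeta bn)
  (gT : finGroupType) (g1 g2 : gT) (g1_order : #[g1]%g = m) (g2_order : #[g2]%g = n)
  (gT_dprod : (<[g1]> \x <[g2]>)%g = [set: gT])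
  (V : 'I_2 -> yd1 k gT) (h1 h2 : gT) (q : 'I_2 -> 'I_2 -> k)
  (h1E : h1 = yd_deg (V 0)) (h2E : h2 = yd_deg (V 1))
  (qE : forall i j, q i j = yd_char (V j) (yd_deg (V i)))
  (B_fin_dim : fin_dim (nichols V))
  (h_gen : <<[set h1; h2]>>%g = [set: gT])
  (alpha1 alpha2 beta1 beta2 s1 s2 t1 t2 : nat)
  (h1_g : h1 = (g1 ^+ alpha1 * g2 ^+ alpha2)%g)
  (h2_g : h2 = (g1 ^+ beta1 * g2 ^+ beta2)%g)
  (g1_h : g1 = (h1 ^+ s1 * h2 ^+ s2)%g)
  (g2_h : g2 = (h1 ^+ t1 * h2 ^+ t2)%g)
  (a b d : nat) (a_lt : (a < bm)%N) (b_lt : (b < bm)%N) (d_lt : (d < bn)%N) :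
  let J := Jabd g1 g2 zeta bm bn a b d in
  (in_twisted_center J (smash (1 : nichols V) (g1 ^+ bm)%g) /\
   in_twisted_center J (smash (1 : nichols V) (g2 ^+ bn)%g))
  <->
  [/\ zeta m ^+ (a * alpha1 * bm) * zeta (bm * bn)%N ^+ (b * alpha2 * bm)
      = q 0 0 ^+ (bm * s1) * q 1 0 ^+ (bm * s2),
      zeta m ^+ (a * beta1 * bm) * zeta (bm * bn)%N ^+ (b * beta2 * bm)
      = q 0 1 ^+ (bm * s1) * q 1 1 ^+ (bm * s2),
      zeta n ^+ (d * alpha2 * bn) = q 0 0 ^+ (bn * t1) * q 1 0 ^+ (bn * t2) &
      zeta n ^+ (d * beta2 * bn) = q 0 1 ^+ (bn * t1) * q 1 1 ^+ (bn * t2)].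
Proof.
subst m n; move=> J.
have c1 : in_twisted_center J (smash (1 : nichols V) (g1 ^+ bm)%g) <->
    forall j, q 0 j ^+ (bm * s1) * q 1 j ^+ (bm * s2) = J (yd_deg (V j)) (g1 ^+ bm)%g.
  (* The character of [V j] takes the values [q 0 j] at [h1] and [q 1 j] at [h2], and [g1] is the
     product of [h1 ^+ s1] and [h2 ^+ s2]. *)
  have E j : yd_char (V j) (g1 ^+ bm)%g = q 0 j ^+ (bm * s1) * q 1 j ^+ (bm * s2).
    by rewrite yd_charX g1_h yd_charM !yd_charX h1E h2E -!qE exprMn -!exprM
      !(mulnC bm).
  by rewrite in_twisted_center_g1 //; split=> H j; have := H j; rewrite E.
have c2 : in_twisted_center J (smash (1 : nichols V) (g2 ^+ bn)%g) <->
    forall j, q 0 j ^+ (bn * t1) * q 1 j ^+ (bn * t2) = J (yd_deg (V j)) (g2 ^+ bn)%g.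
  have E j : yd_char (V j) (g2 ^+ bn)%g = q 0 j ^+ (bn * t1) * q 1 j ^+ (bn * t2).
    by rewrite yd_charX g2_h yd_charM !yd_charX h1E h2E -!qE exprMn -!exprM
      !(mulnC bn).
  by rewrite in_twisted_center_g2 //; split=> H j; have := H j; rewrite E.
rewrite c1 c2.
have J1 x1 x2 : J (g1 ^+ x1 * g2 ^+ x2)%g (g1 ^+ bm)%g =
    zeta (bm ^ 2)%N ^+ (a * x1 * bm) * zeta (bm * bn)%N ^+ (b * x2 * bm).
  exact: Jabd_g1r.
have J2 x1 x2 : J (g1 ^+ x1 * g2 ^+ x2)%g (g2 ^+ bn)%g =
    zeta (bn ^ 2)%N ^+ (d * x2 * bn).
  exact: Jabd_g2r.
have two (P : 'I_2 -> Prop) : (forall j, P j) <-> P 0 /\ P 1.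
  split=> [H|[P0 P1] j]; first by split.
  case: j => [[|[|//]] j_lt].
  - by rewrite (_ : Ordinal j_lt = 0) //; apply: val_inj.
  - by rewrite (_ : Ordinal j_lt = 1) //; apply: val_inj.
(* Each of the two conditions splits into [j = 0] and [j = 1], whose degrees have coordinates
   [alpha1], [alpha2] and [beta1], [beta2]; this gives the four equations, with sides exchanged. *)
rewrite !two -h1E -h2E h1_g h2_g !J1 !J2.
by split=> [[[<- <-] [<- <-]]|[-> -> -> ->]].
Qed.
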